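(* For an odd prime $q$, let $\widetilde{\mathcal N}(2q)$ be the number of (centrally) nilpotent loops of order $2q$ counted up to isotopism, and let $\mathcal N(2q)$ be the number of nilpotent loops of order $2q$ counted up to isomorphism. Then $$\lim_{q\text{ prime},\ q\to\infty}\widetilde{\mathcal N}(2q)\cdot\frac{q^2(q-1)}{2^{(q-2)(q-1)}}=1\qquad\text{and}\qquad \lim_{q\text{ prime},\ q\to\infty}\frac{\mathcal N(2q)}{q^2\cdot\widetilde{\mathcal N}(2q)}=1.$$
   Context: A loop is a set $Q$ with a binary operation having a two-sided neutral element and such that for all $a,b\in Q$ the equations $a\cdot x=b$ and $y\cdot a=b$ have unique solutions $x,y$. The center $Z(Q)$ is the set of $x\in Q$ with $xy=yx$, $(xy)z=x(yz)$, $(yx)z=y(xz)$, $(yz)x=y(zx)$ for all $y,z\in Q$; it is a normal subloop (normal subloops are kernels of loop homomorphisms). The upper central series is given by $Z_0(Q)=1$ and $Z_{i+1}(Q)$ the preimage in $Q$ of $Z(Q/Z_i(Q))$. $Q$ is (centrally) nilpotent if $Z_n(Q)=Q$ for some $n$. Two loops $(L_1,\cdot)$, $(L_2,\ast)$ are isotopic if there are bijections $\alpha,\beta,\gamma:L_1\to L_2$ with $\alpha(x)\ast\beta(y)=\gamma(x\cdot y)$ for all $x,y\in L_1$; such a triple is an isotopism. Counting ''up to isotopism'' (resp. ''up to isomorphism'') means counting isotopy (resp. isomorphism) classes. *)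

(* Defs.v *)
From HB Require Import structures.
From mathcomp Require Import all_boot all_order all_algebra.
From mathcomp Require Import boolp reals topology normedtype.

Set Implicit Arguments.
Unset Strict Implicit.
Unset Printing Implicit Defensive.

Definition is_loop (T : finType) (m : T -> T -> T) (e : T) : Prop :=
  [/\ forall x, m e x = x,
      forall x, m x e = x,
      forall a b, exists! x, m a x = b
    & forall a b, exists! y, m y a = b].

(* A multiplication table on T together with its neutral element; the table   *)
(* is a finfun, so that loop T is itself a finite type.                       *)
Record loop (T : finType) := Loop {
  loopval :> {ffun T * T -> T} * T;
  _ : `[< is_loop (fun x y => loopval.1 (x, y)) loopval.2 >] }.

HB.instance Definition _ (T : finType) := [isSub for @loopval T].
HB.instance Definition _ (T : finType) := [Finite of loop T by <:].

Definition lmul (T : finType) (Q : loop T) (x y : T) : T := (loopval Q).1 (x, y).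
Definition lone (T : finType) (Q : loop T) : T := (loopval Q).2.

Lemma loopP (T : finType) (Q : loop T) : is_loop (lmul Q) (lone Q).
Proof. by apply/asboolP; case: Q. Qed.

Definition isotopic (T1 T2 : finType) (Q1 : loop T1) (Q2 : loop T2) : Prop :=
  exists alpha beta gamma : T1 -> T2,
    [/\ bijective alpha, bijective beta, bijective gamma
      & forall x y, lmul Q2 (alpha x) (beta y) = gamma (lmul Q1 x y)].

Definition isomorphic (T1 T2 : finType) (Q1 : loop T1) (Q2 : loop T2) : Prop :=
  exists2 f : T1 -> T2,
    bijective f & forall x y, f (lmul Q1 x y) = lmul Q2 (f x) (f y).

(* The center of the binary system (G, op) carried by a subset G of U. It is  *)
(* stated for subsets so that it also applies to a quotient, whose elements   *)
(* are cosets, i.e. some of the elements of {set T}.                          *)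
Definition center_in (U : finType) (op : U -> U -> U) (G : {set U}) : {set U} :=
  [set x in G | [forall y in G, forall z in G,
     [&& op x y == op y x,
         op (op x y) z == op x (op y z),
         op (op y x) z == op y (op x z)
       & op (op y z) x == op y (op z x)]]].

Section Quotient.
Variables (T : finType) (Q : loop T).

Definition coset_mul (A B : {set T}) : {set T} :=
  [set lmul Q a b | a in A, b in B].

Definition lcoset_of (x : T) (N : {set T}) : {set T} :=
  [set lmul Q x n | n in N].

(* For a normal subloop N, Q/N is the set of cosets xN with the elementwise   *)
(* product of sets, which satisfies (xN)(yN) = (xy)N: see coset_mulE.         *)
Definition quotient_of (N : {set T}) : {set {set T}} :=
  [set lcoset_of x N | x in [set: T]].

Fixpoint upper_central (i : nat) : {set T} :=
  if i is j.+1 then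
    [set x | lcoset_of x (upper_central j)
               \in center_in coset_mul (quotient_of (upper_central j))]
  else [set lone Q].

Definition nilpotent_loop : Prop := exists n, upper_central n = [set: T].

End Quotient.

Section KernelCosets.
Variables (T T' : finType) (Q : loop T) (Q' : loop T') (f : T -> T').
Hypothesis fM : forall x y, f (lmul Q x y) = lmul Q' (f x) (f y).
Let N := [set x | f x == lone Q'].

Lemma lcoset_kerE x : lcoset_of Q x N = [set y | f y == f x].
Proof.
have [_ mr1 divl _] := loopP Q'; have [_ _ Ql _] := loopP Q.
apply/setP => y; rewrite inE; apply/imsetP/eqP.
  by move=> [n]; rewrite inE => /eqP fn ->; rewrite fM fn mr1.
move=> fy; have [n [yE _]] := Ql x y; exists n => //; rewrite inE; apply/eqP.
have [u [_ uP]] := divl (f x) (f x).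
by rewrite -(uP (f n)) -?fM ?yE // (uP (lone Q')) ?mr1.
Qed.

Lemma coset_mulE x y :
  coset_mul Q (lcoset_of Q x N) (lcoset_of Q y N) = lcoset_of Q (lmul Q x y) N.
Proof.
have [_ _ divl _] := loopP Q'; have [_ _ Ql _] := loopP Q.
rewrite !lcoset_kerE; apply/setP => z; rewrite inE; apply/imset2P/eqP.
  by move=> [a b]; rewrite !inE => /eqP fa /eqP fb ->; rewrite !fM fa fb.
move=> fz; have [b [zE _]] := Ql x z.
exists x b => //; rewrite inE // fM in fz *; apply/eqP.
have [u [_ uP]] := divl (f x) (f z).
by rewrite -(uP (f b)) -?fM ?zE // (uP (f y)).
Qed.

End KernelCosets.

Definition nilpotent_loops (n : nat) : {set loop 'I_n} :=
  [set Q | `[< nilpotent_loop Q >]].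

(* Every loop of order n is isomorphic to one carried by 'I_n, so classes of  *)
(* loops of order n are counted among the latter.                             *)
Definition nilpotent_upto_isotopism (n : nat) : nat :=
  #|equivalence_partition (fun P Q => `[< isotopic P Q >]) (nilpotent_loops n)|.

Definition nilpotent_upto_isomorphism (n : nat) : nat :=
  #|equivalence_partition (fun P Q => `[< isomorphic P Q >]) (nilpotent_loops n)|.

(* Main.v *)
Require Import Defs.
From HB Require Import structures.
From mathcomp Require Import all_boot all_order all_algebra.
From mathcomp Require Import fingroup perm pgroup boolp ring zify.
Import GRing.Theory.

Set Implicit Arguments.
Unset Strict Implicit.
Unset Printing Implicit Defensive.

(** A nilpotent loop of order 2q has a central involution z with Q/<z> cyclic of
    order q, so it is F_q x F_2 with (x,a)(y,b) = (x+y, a+b+c(x,y)) for one of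
    the 2^((q-1)^2) normalized cocycles c. In such a loop L_u L_v^-1 is an
    involution only if u and v lie over the same point of F_q (q is odd), so
    isotopisms respect the fibration over F_q and induce affine maps
    x |-> rx+s, y |-> ry+t there. Hence isotopism classes are the orbits of the
    q^2 (q-1) 2^(q-1) transformations "pull back along (r,s,t), renormalize, add
    the coboundary of tau", and isomorphism classes those of the subfamily
    s = t = 0. Two distinct transformations agree only on a set of cocycles of
    size 2^(2q^2/3 + O(q)), because an affine map other than the identity moves
    some third of F_q off itself; so all but a negligible set of orbits are
    regular, and both limits follow by dividing. *)

(** * Centers and central quotients *)

Section SubsetLoop.
Variables (U : finType) (op : U -> U -> U) (G : {set U}) (e : U).
Hypotheses (opG : forall x y, x \in G -> y \in G -> op x y \in G)
  (eG : e \in G) (opx1 : forall x, x \in G -> op x e = x)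
  (op1x : forall x, x \in G -> op e x = x)
  (opI : forall a x y, a \in G -> x \in G -> y \in G -> op a x = op a y -> x = y).

Definition central x := x \in G /\ forall y z, y \in G -> z \in G ->
  [/\ op x y = op y x, op (op x y) z = op x (op y z),
      op (op y x) z = op y (op x z) & op (op y z) x = op y (op z x)].

Lemma center_inP x : reflect (central x) (x \in center_in op G).
Proof.
rewrite inE; apply: (iffP andP) => -[Gx Hx]; split=> //.
  move=> y z Gy Gz.
  by have /forall_inP/(_ z Gz)/and4P[/eqP-> /eqP-> /eqP-> /eqP->] := forall_inP Hx y Gy.
apply/forall_inP => y Gy; apply/forall_inP => z Gz.
by have [-> -> -> ->] := Hx y z Gy Gz; rewrite !eqxx.
Qed.

Lemma center_in1 : e \in center_in op G.
Proof.
apply/center_inP; split=> // y z Gy Gz.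
by rewrite !(op1x, opx1) ?opG.
Qed.

Lemma center_inM x y : x \in center_in op G -> y \in center_in op G ->
  op x y \in center_in op G.
Proof.
move=> /center_inP[Gx Cx] /center_inP[Gy Cy]; apply/center_inP; split; first exact: opG.
move=> u v Gu Gv; have Gxy := opG Gx Gy.
have xA a b (Ga : a \in G) (Gb : b \in G) : op (op x a) b = op x (op a b) by have [] := Cx a b Ga Gb.
have yA a b (Ga : a \in G) (Gb : b \in G) : op (op y a) b = op y (op a b) by have [] := Cy a b Ga Gb.
have xM a b (Ga : a \in G) (Gb : b \in G) : op (op a x) b = op a (op x b) by have [] := Cx a b Ga Gb.
have yM a b (Ga : a \in G) (Gb : b \in G) : op (op a y) b = op a (op y b) by have [] := Cy a b Ga Gb.
have xR a b (Ga : a \in G) (Gb : b \in G) : op (op a b) x = op a (op b x) by have [] := Cx a b Ga Gb.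
have yR a b (Ga : a \in G) (Gb : b \in G) : op (op a b) y = op a (op b y) by have [] := Cy a b Ga Gb.
have xC a (Ga : a \in G) : op x a = op a x by have [] := Cx a a Ga Ga.
have yC a (Ga : a \in G) : op y a = op a y by have [] := Cy a a Ga Ga.
split.
- by rewrite xA // yC // -xA // xC // xM.
- by rewrite !xA ?opG // yA.
- by rewrite -(xM u y) // yM ?opG // xM ?opG // xA.
- by rewrite -!yR ?opG // xR.
Qed.

Section Cosets.
Variable H : {set U}.
Hypotheses (HC : H \subset center_in op G) (H1 : e \in H)
  (HM : {in H &, forall x y, op x y \in H}).

Lemma central_mem h : h \in H -> h \in G.
Proof. by move=> /(subsetP HC)/center_inP[]. Qed.

Let cst x := [set op x h | h in H].

Lemma card_central_coset x : x \in G -> #|cst x| = #|H|.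
Proof.
move=> Gx; apply: card_in_imset => h k Hh Hk; apply: opI => //; exact: central_mem.
Qed.

(** Centrality of h gives [(x h) k = x (h k)], so the coset of [x h] is contained in the coset of x.
    Both have as many elements as H, so counting replaces inverses in H. *)
Lemma central_coset_id x y : x \in G -> y \in cst x -> cst y = cst x.
Proof.
move=> Gx /imsetP[h Hh ->]; apply/eqP; rewrite eqEcard.
have Gh := central_mem Hh.
rewrite !card_central_coset ?opG // leqnn andbT; apply/subsetP => _ /imsetP[k Hk ->].
have /center_inP[_ /(_ x k Gx (central_mem Hk))[_ _ -> _]] := subsetP HC _ Hh.
by apply: imset_f; apply: HM.
Qed.

Lemma central_coset_refl x : x \in G -> x \in cst x.
Proof. by move=> Gx; apply/imsetP; exists e => //; rewrite opx1. Qed.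

(** Lagrange's theorem for a closed set of central elements: its cosets all have the size of H and
    partition G. *)
Lemma card_central_cosets : #|G| = (#|[set cst x | x in G]| * #|H|)%N.
Proof.
apply: card_uniform_partition.
  by move=> _ /imsetP[x Gx ->]; apply: card_central_coset.
apply/and3P; split.
- apply/eqP/setP => y; apply/bigcupP/idP.
    move=> [_ /imsetP[x Gx ->] /imsetP[h Hh ->]].
    by apply: opG => //; apply: central_mem.
  by move=> Gy; exists (cst y); [apply: imset_f | apply: central_coset_refl].
- apply/trivIsetP => _ _ /imsetP[x Gx ->] /imsetP[y Gy ->]; apply: contraNT.
  by case/pred0Pn => z /andP[zx zy]; rewrite -(central_coset_id Gx zx) (central_coset_id Gy zy).
- apply/negP => /imsetP[x Gx E].
  by have := central_coset_refl Gx; rewrite -E inE.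
Qed.

Lemma central_subset_dvdn : #|H| %| #|G|.
Proof. by rewrite card_central_cosets dvdn_mull. Qed.

End Cosets.

Local Open Scope ring_scope.

(** When G is its own center it is an abelian group, here of prime order. The map f is the discrete
    logarithm to a base [a] other than [e], whose powers exhaust G by Lagrange. *)
Lemma prime_order_hom q : prime q -> #|G| = q -> center_in op G = G ->
  exists f : U -> 'F_q,
    {in G &, forall x y, f (op x y) = f x + f y} /\ {in G &, injective f}.
Proof.
move=> q_pr cG CG.
have opA a b c : a \in G -> b \in G -> c \in G -> op (op a b) c = op a (op b c).
  by move=> Ga Gb Gc; move: (Ga); rewrite -CG => /center_inP[_ /(_ b c Gb Gc)[]].
have [a Ga ae] : exists2 a, a \in G & a != e.
  have /card_gt0P[a] : (0 < #|G :\ e|)%N.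
    by have := prime_gt1 q_pr; rewrite -{1}cG (cardsD1 e G) eG.
  by rewrite !inE => /andP[? ?]; exists a.
(* Left translation by [a], extended by the identity outside G, is injective on the whole type, so
   its orbit through [e] has the usual theory of iterates. *)
pose s x := if x \in G then op a x else x.
have sG x : (s x \in G) = (x \in G) by rewrite /s; case: ifP => // Gx; rewrite opG.
have sI : injective s.
  move=> x y exy; have := sG x; rewrite exy sG => Gxy.
  by move: exy; rewrite /s Gxy; case: ifP => // Gx /opI; apply=> //; rewrite Gxy.
pose pw n := iter n s e.
have pwG n : pw n \in G by elim: n => //= n IHn; rewrite sG.
have pwD m n : pw (m + n)%N = op (pw m) (pw n).
  elim: m => [|m IHm]; first by rewrite add0n op1x.
  by rewrite addSn /= -/(pw (m + n)%N) -/(pw m) IHm /s opG // pwG opA.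
pose H := [set x | fconnect s e x].
have HP x : reflect (exists n, x = pw n) (x \in H).
  rewrite inE; apply: (iffP idP) => [/iter_findex <-|[n ->]]; last exact: fconnect_iter.
  by exists (findex s e x).
have HG : H \subset center_in op G.
  by rewrite CG; apply/subsetP => x /HP[n ->].
have cH : #|H| = fingraph.order s e by rewrite cardsE.
have He : e \in H by apply/HP; exists 0.
have Ha : a \in H by apply/HP; exists 1%N; rewrite /pw /= /s eG opx1.
have: (#|H| %| #|G|)%N.
  apply: central_subset_dvdn => // _ _ /HP[m ->] /HP[n ->].
  by apply/HP; exists (m + n)%N.
have cH1 : #|H| != 1%N.
  by apply/cards1P => -[b Eb]; move: He Ha ae; rewrite Eb !inE => /eqP-> ->.
rewrite cG => /(prime_nt_dvdP q_pr cH1) cHq; have HE : H = G.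
  by apply/eqP; rewrite eqEcard -{1}CG HG cG cHq leqnn.
have oq : fingraph.order s e = q by rewrite -cH.
have pwq : pw q = e by rewrite /pw -oq iter_order.
have pwM n : pw (n %% q)%N = pw n.
  rewrite {2}(divn_eq n q); elim: (_ %/ _)%N => [|k IHk] //.
  by rewrite mulSn -addnA pwD pwq op1x.
(* [findex] counts the translations by [a] that lead from [e] to u, that is, the exponent of u. *)
pose f u : 'F_q := (findex s e u)%:R.
have fpw n : f (pw n) = n%:R.
  rewrite /f -pwM findex_iter ?oq ?ltn_pmod ?prime_gt0 //.
  by apply: val_inj; rewrite /= !val_Fp_nat // modn_mod.
exists f; split=> [x y|x y].
  rewrite -HE => /HP[m ->] /HP[n ->]; by rewrite -pwD !fpw natrD.
rewrite -HE => /HP[m ->] /HP[n ->]; rewrite !fpw => /(congr1 val).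
by rewrite /= !val_Fp_nat // => E; rewrite -pwM E pwM.
Qed.

End SubsetLoop.

(** * Center, central quotients and upper central series of a loop *)

Section Loop.
Variables (T : finType) (Q : loop T).

Notation "x ∘ y" := (lmul Q x y) (at level 40, left associativity).
Notation one := (lone Q).

Lemma lmul1x x : one ∘ x = x. Proof. by have [] := loopP Q. Qed.
Lemma lmulx1 x : x ∘ one = x. Proof. by have [] := loopP Q. Qed.
Lemma lmulI x : injective (lmul Q x).
Proof.
have [_ _ d _] := loopP Q; move=> y z E.
by have [u [_ uP]] := d x (x ∘ y); rewrite -(uP y) // (uP z).
Qed.
Lemma lmulIr x : injective (lmul Q ^~ x).
Proof.
have [_ _ _ d] := loopP Q; move=> y z /= E.
by have [u [_ uP]] := d x (y ∘ x); rewrite -(uP y) // (uP z).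
Qed.
Lemma ldiv_ex x y : exists z, x ∘ z = y.
Proof. by have [_ _ d _] := loopP Q; have [u [uP _]] := d x y; exists u. Qed.

Definition lcenter := center_in (lmul Q) setT.

Lemma lcenterP x : reflect (forall y z,
  [/\ x ∘ y = y ∘ x, x ∘ y ∘ z = x ∘ (y ∘ z),
      y ∘ x ∘ z = y ∘ (x ∘ z) & y ∘ z ∘ x = y ∘ (z ∘ x)]) (x \in lcenter).
Proof.
apply: (iffP (center_inP _ _ _)) => [[_ H] y z|H]; first by apply: H; rewrite inE.
by split=> [|y z _ _]; [rewrite inE | apply: H].
Qed.

Lemma lcenter1 : one \in lcenter.
Proof.
by apply: center_in1 => //; move=> *; rewrite ?inE ?lmul1x ?lmulx1.
Qed.

Lemma lcenterM x y : x \in lcenter -> y \in lcenter -> x ∘ y \in lcenter.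
Proof. by apply: center_inM => // *; rewrite inE. Qed.

Lemma lcenterC x y : x \in lcenter -> x ∘ y = y ∘ x.
Proof. by move=> /lcenterP/(_ y y)[]. Qed.
Lemma lcenterAl x y z : x \in lcenter -> x ∘ y ∘ z = x ∘ (y ∘ z).
Proof. by move=> /lcenterP/(_ y z)[]. Qed.
Lemma lcenterAm x y z : x \in lcenter -> y ∘ x ∘ z = y ∘ (x ∘ z).
Proof. by move=> /lcenterP/(_ y z)[]. Qed.
Lemma lcenterAr x y z : x \in lcenter -> y ∘ z ∘ x = y ∘ (z ∘ x).
Proof. by move=> /lcenterP/(_ y z)[]. Qed.

Section CentralQuotient.
Variable N : {set T}.
Hypotheses (NC : N \subset lcenter) (N1 : one \in N)
  (NM : {in N &, forall x y, x ∘ y \in N}).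

Lemma lcoset_refl x : x \in lcoset_of Q x N.
Proof. by apply/imsetP; exists one => //; rewrite lmulx1. Qed.

Lemma lcoset_eqP x y : reflect (exists2 n, n \in N & y = x ∘ n)
  (lcoset_of Q x N == lcoset_of Q y N).
Proof.
apply: (iffP eqP) => [E|[n Nn ->]].
  by have := lcoset_refl y; rewrite -E => /imsetP.
apply/esym; apply: (central_coset_id (op := lmul Q) (G := setT)) => //.
- by move=> a b c _ _ _; apply: lmulI.
- exact: imset_f.
Qed.

Lemma coset_mulE_central x y :
  coset_mul Q (lcoset_of Q x N) (lcoset_of Q y N) = lcoset_of Q (x ∘ y) N.
Proof.
apply/setP => z; apply/imset2P/imsetP.
  move=> [_ _ /imsetP[n Nn ->] /imsetP[m Nm ->] ->].
  have [Cn Cm] := (subsetP NC _ Nn, subsetP NC _ Nm).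
  exists (n ∘ m); first exact: NM.
  by rewrite lcenterAm // -(lcenterAr _ _ Cm) -(lcenterAr _ _ Cm)
    (lcenterC _ Cn) -(lcenterAr _ _ Cn) -!(lcenterAr _ _ Cm).
move=> [n Nn ->]; exists x (y ∘ n); rewrite ?lcoset_refl ?imset_f //.
by rewrite lcenterAr //; apply: (subsetP NC).
Qed.

Lemma quotient_mem x : lcoset_of Q x N \in quotient_of Q N.
Proof. by apply/imset_f; rewrite inE. Qed.

Lemma quotientP A : reflect (exists x, A = lcoset_of Q x N) (A \in quotient_of Q N).
Proof.
by apply: (iffP imsetP) => [[x _ ->]|[x ->]]; exists x; rewrite ?inE.
Qed.

Lemma quotient_opG A B : A \in quotient_of Q N -> B \in quotient_of Q N ->
  coset_mul Q A B \in quotient_of Q N.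
Proof. by move=> /quotientP[x ->] /quotientP[y ->]; rewrite coset_mulE_central quotient_mem. Qed.

Lemma quotient_op1 A : A \in quotient_of Q N -> coset_mul Q A (lcoset_of Q one N) = A.
Proof. by move=> /quotientP[x ->]; rewrite coset_mulE_central lmulx1. Qed.

Lemma quotient_1op A : A \in quotient_of Q N -> coset_mul Q (lcoset_of Q one N) A = A.
Proof. by move=> /quotientP[x ->]; rewrite coset_mulE_central lmul1x. Qed.

Lemma quotient_opI A B C : A \in quotient_of Q N -> B \in quotient_of Q N ->
  C \in quotient_of Q N -> coset_mul Q A B = coset_mul Q A C -> B = C.
Proof.
move=> /quotientP[x ->] /quotientP[y ->] /quotientP[z ->].
rewrite !coset_mulE_central => /eqP/lcoset_eqP[n Nn E].
apply/eqP/lcoset_eqP; exists n => //; apply: (@lmulI x).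
by rewrite E lcenterAr //; apply: (subsetP NC).
Qed.

Lemma card_quotient : #|T| = (#|quotient_of Q N| * #|N|)%N.
Proof.
rewrite -cardsT; apply: (card_central_cosets (op := lmul Q) (e := one)) => //.
- by move=> *; rewrite lmulx1.
- by move=> *; apply: lmulI; eauto.
Qed.

Lemma quotient_centerP x :
  reflect (forall y z, let C := lcoset_of Q ^~ N in
    [/\ C (x ∘ y) = C (y ∘ x), C (x ∘ y ∘ z) = C (x ∘ (y ∘ z)),
      C (y ∘ x ∘ z) = C (y ∘ (x ∘ z)) & C (y ∘ z ∘ x) = C (y ∘ (z ∘ x))])
   (lcoset_of Q x N \in center_in (coset_mul Q) (quotient_of Q N)).
Proof.
apply: (iffP (center_inP _ _ _)) => [[_ H] y z|H].
  by have := H _ _ (quotient_mem y) (quotient_mem z); rewrite !coset_mulE_central.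
split=> [|_ _ /quotientP[y ->] /quotientP[z ->]]; first exact: quotient_mem.
by rewrite !coset_mulE_central; apply: H.
Qed.

End CentralQuotient.

Lemma lcenter_sub1 : [set one] \subset lcenter.
Proof. by rewrite sub1set lcenter1. Qed.

Lemma lcoset_set1 x : lcoset_of Q x [set one] = [set x].
Proof. by rewrite /lcoset_of imset_set1 lmulx1. Qed.

Lemma upper_central1 : upper_central Q 1 = lcenter.
Proof.
have M1 : {in [set one] &, forall x y, x ∘ y \in [set one]}.
  by move=> x y /set1P-> /set1P->; rewrite lmulx1 set11.
apply/setP => x; rewrite inE.
apply/(quotient_centerP lcenter_sub1 (set11 _) M1)/lcenterP => H y z.
  by have /= := H y z; rewrite !lcoset_set1 => -[/set1_inj-> /set1_inj-> /set1_inj-> /set1_inj->].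
by have [-> -> -> ->] := H y z.
Qed.

(** Nilpotency is exploited through this: a series that stalls before reaching the whole loop never
    reaches it. *)
Lemma upper_central_fix i n : upper_central Q i.+1 = upper_central Q i ->
  upper_central Q (n + i) = upper_central Q i.
Proof. by move=> E; elim: n => // n; rewrite addSn /= => ->. Qed.

(** Elements with the same image under f differ by a factor in the kernel, hence share a coset of
    the center. The quotient by the center thus inherits commutativity and associativity from
    addition, so the second term of the series is everything. *)
Lemma nilpotent_hom (q : nat) (f : T -> 'F_q) :
  (forall x y, f (x ∘ y) = (f x + f y)%R) ->
  (forall k, f k = 0%R -> k \in lcenter) -> nilpotent_loop Q.
Proof.
move=> fM fK; exists 2; apply/setP => x.
have -> : upper_central Q 2 = [set x | lcoset_of Q x lcenter
   \in center_in (coset_mul Q) (quotient_of Q lcenter)] by rewrite -upper_central1.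
rewrite in_setT in_set.
have NM : {in lcenter &, forall x y, x ∘ y \in lcenter} by move=> u v; apply: lcenterM.
have key u v : f u = f v -> lcoset_of Q u lcenter = lcoset_of Q v lcenter.
  move=> E; have [k Ek] := ldiv_ex u v; apply/eqP/(lcoset_eqP (subxx _) lcenter1 NM).
  exists k => //; apply: fK; apply: (addrI (f u)); by rewrite -fM Ek addr0.
apply/(quotient_centerP (subxx _) lcenter1 NM) => y z /=.
by split; apply: key; rewrite !fM -?addrA // addrC.
Qed.

End Loop.

(** * Nilpotent loops of order 2q as central extensions *)

Definition extmul (q : nat) (c : 'F_q -> 'F_q -> bool) (u v : 'F_q * bool) :=
  ((u.1 + v.1)%R, u.2 (+) v.2 (+) c u.1 v.1).

Definition normalized (q : nat) (c : 'F_q -> 'F_q -> bool) :=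
  forall x, c x 0%R = false /\ c 0%R x = false.

Section Classification.
Variables (T : finType) (Q : loop T).

Notation "x ∘ y" := (lmul Q x y) (at level 40, left associativity).
Notation one := (lone Q).
Notation Z := (lcenter Q).

Lemma lcenter_comm a : (forall x y, x ∘ y = y ∘ x) ->
  (forall x y, a ∘ x ∘ y = a ∘ (x ∘ y)) -> a \in Z.
Proof.
move=> C A; apply/lcenterP => x y; split=> //.
- by rewrite (C x a) A (C x (a ∘ y)) A (C y x).
- by rewrite (C (x ∘ y) a) (C x (y ∘ a)) (C y a) A (C y x).
Qed.

(** Analogue of the fact that a group with cyclic central quotient is abelian. If the center Z had
    index 2, the loop would be the union of Z and aZ; products on these two cosets show that it is
    commutative and that [a] is central, a contradiction. *)
Lemma lcenter_not_half : #|T| <> (2 * #|Z|)%N.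
Proof.
move=> cT.
have ZM : {in Z &, forall x y, x ∘ y \in Z} by move=> x y; apply: lcenterM.
have [a Za] : exists a, a \notin Z.
  apply/existsP; rewrite -negb_forall; apply/forallP => ZT.
  have ZE : Z = setT by apply/setP => x; rewrite ZT inE.
  move: cT; rewrite ZE cardsT mul2n -addnn => /eqP.
  rewrite -{1}[#|T|]addn0 eqn_add2l => /eqP c0.
  by have := fintype0 one; rewrite -c0 => /(_ erefl).
(* Right multiplication by k permutes Z, so [a ∘ k] in Z would force [a] in Z. *)
have aC k : k \in Z -> a ∘ k \notin Z.
  move=> Zk; apply: contra Za; have E : [set x ∘ k | x in Z] = Z.
    apply/eqP; rewrite eqEcard card_imset ?leqnn ?andbT; last exact: lmulIr.
    by apply/subsetP => _ /imsetP[x Zx ->]; apply: ZM.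
  by rewrite -{1}E => /imsetP[j Zj /lmulIr->].
have split_a x : x \in Z \/ exists2 k, k \in Z & x = a ∘ k.
  have E : Z :|: lcoset_of Q a Z = setT.
    apply/eqP; rewrite eqEcard subsetT cardsT cT cardsU.
    rewrite (card_imset _ (@lmulI _ Q a)).
    have -> : Z :&: lcoset_of Q a Z = set0.
      apply/setP => y; rewrite in_setI in_set0; apply/negP => /andP[Zy /imsetP[k Zk E]].
      by have := aC k Zk; rewrite -E Zy.
    by rewrite cards0 subn0 addnn mul2n leqnn.
  by have := in_setT x; rewrite -E in_setU => /orP[|/imsetP]; [left|right].
have Zaa : a ∘ a \in Z.
  have [//|[k Zk /lmulI ak]] := split_a (a ∘ a).
  by rewrite ak Zk in Za.
have aaE k l : k \in Z -> l \in Z -> a ∘ k ∘ (a ∘ l) = a ∘ a ∘ k ∘ l.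
  move=> Zk Zl; rewrite -(lcenterAr _ _ Zl) (lcenterAm _ _ Zk) (lcenterC _ Zk).
  by rewrite -(lcenterAr _ _ Zk).
have Cm x y : x ∘ y = y ∘ x.
  have [Zx|[k Zk ->]] := split_a x; first exact: lcenterC.
  have [Zy|[l Zl ->]] := split_a y; first exact/esym/lcenterC.
  by rewrite !aaE // (lcenterAl _ _ Zaa) (lcenterC l Zk) -(lcenterAl _ _ Zaa).
suff : a \in Z by apply/negP.
apply: lcenter_comm => // x y.
have [Zx|[k Zk ->]] := split_a x; first exact: lcenterAm.
have [Zy|[l Zl ->]] := split_a y; first by rewrite lcenterAr.
have Zaak : a ∘ a ∘ k \in Z by apply: ZM.
rewrite (aaE k l) // -(lcenterAr a a Zk) -(lcenterAr _ a Zl).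
by rewrite (lcenterC a Zaak) (lcenterAr _ _ Zl).
Qed.

(** With full center the loop is an abelian group; its left translations form a permutation group of
    the same even order, to which Cauchy's theorem applies. *)
Lemma comm_involution (q : nat) : #|T| = (2 * q)%N -> Z = setT ->
  exists2 z, z != one & z ∘ z = one.
Proof.
move=> cT ZT.
have A x y z : x ∘ y ∘ z = x ∘ (y ∘ z) by apply: lcenterAl; rewrite ZT inE.
pose L x := perm (@lmulI _ Q x).
have gL : group_set [set L x | x in [set: T]].
  apply/group_setP; split.
    by apply/imsetP; exists one; rewrite ?inE //; apply/permP => x; rewrite perm1 permE lmul1x.
  move=> _ _ /imsetP[x _ ->] /imsetP[y _ ->].
  apply/imsetP; exists (y ∘ x); rewrite ?inE //.
  by apply/permP => w; rewrite permM !permE A.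
have LI : injective L.
  by move=> x y /permP/(_ one); rewrite !permE !lmulx1.
have [|s /imsetP[z _ ->] oz] := @Cauchy _ 2 (Group gL) isT.
  by rewrite /= card_imset // cardsT cT dvdn_mulr.
exists z.
  apply/eqP => z1; suff E : L z = 1%g by move: oz; rewrite E order1.
  by apply/permP => x; rewrite permE perm1 z1 lmul1x.
have /permP/(_ one) := expg_order (L z); rewrite oz expgS expg1 permM perm1 !permE.
by rewrite lmulx1.
Qed.

(** The order of the center divides 2q; it is not 1 by nilpotency, nor q by [lcenter_not_half]. So
    either the loop is an abelian group, where any involution serves, or the center has order 2 and
    its quotient has prime order q. *)
Lemma nilpotent_central_involution (q : nat) : prime q -> odd q ->
  #|T| = (2 * q)%N -> nilpotent_loop Q ->
  exists z, [/\ z \in Z, z != one, z ∘ z = one &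
    center_in (coset_mul Q) (quotient_of Q [set one; z]) = quotient_of Q [set one; z]].
Proof.
move=> q_pr q_odd cT [n nilQ].
have q0 := prime_gt0 q_pr; have q1 := prime_gt1 q_pr.
have ZM : {in Z &, forall x y, x ∘ y \in Z} by move=> x y; apply: lcenterM.
have Z1 := lcenter1 Q.
have cTZ := card_quotient (subxx Z) Z1 ZM.
have Zn1 : Z != [set one].
  apply/eqP => ZE; have := upper_central_fix (Q := Q) (i := 0) n.
  rewrite upper_central1 ZE addn0 nilQ => /(_ erefl) /(congr1 (fun A : {set T} => #|A|)).
  by rewrite cardsT cT cards1; case: q q1 {q_pr q_odd q0 cT} => [|[|]].
have cZ1 : #|Z| != 1%N.
  apply: contraNN Zn1 => /cards1P[x Zx]; rewrite Zx.
  by move: Z1; rewrite Zx => /set1P->.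
have [ZT|ZT] := eqVneq Z setT.
  have [z z1 zz] := comm_involution cT ZT.
  exists z; split; rewrite ?ZT ?inE //.
  have ZA x : x \in Z by rewrite ZT inE.
  have KC : [set one; z] \subset Z by rewrite ZT.
  have KM : {in [set one; z] &, forall x y, x ∘ y \in [set one; z]}.
    by move=> x y /set2P[]-> /set2P[]->; rewrite ?zz ?lmulx1 ?lmul1x !inE !eqxx ?orbT.
  apply/eqP; rewrite eqEsubset; apply/andP; split.
    by apply/subsetP => A /center_inP[].
  apply/subsetP => A /quotientP[x ->].
  apply/(quotient_centerP KC (set21 _ _) KM) => y w /=.
  by rewrite !(lcenterAl _ _ (ZA _)) (lcenterC x (ZA y)).
have cZ2 : #|Z| = 2.
  have dZ : #|Z| %| 2 * q by rewrite -cT cTZ dvdn_mull.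
  have cZ : #|Z| <> (2 * q)%N.
    move=> E; case/eqP: ZT; apply/eqP; rewrite eqEcard subsetT cardsT cT E leqnn //.
  have nh := lcenter_not_half; rewrite cT in nh.
  have [q_dvd|] := boolP (q %| #|Z|).
    case/dvdnP: q_dvd => k kE; move: dZ cZ nh cZ1; rewrite kE dvdn_pmul2r //.
    by case: k {kE} => [|[|[|k]]] //; rewrite ?mul1n.
  rewrite -prime_coprime // coprime_sym => cop.
  move: dZ; rewrite Gauss_dvdl // => /(prime_nt_dvdP _ cZ1); exact.
have [z zE] : exists z, Z = [set one; z].
  have /cards2P[x [y [xy Zxy]]] : #|Z| == 2 by rewrite cZ2.
  by move: Z1; rewrite Zxy => /set2P[->|->]; [exists y | exists x; rewrite setUC].
have z1 : z != one by apply/eqP => E; move: cZ2; rewrite zE E setUid cards1.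
have Zz : z \in Z by rewrite zE set22.
exists z; split=> //.
  have := ZM z z Zz Zz; rewrite {1}zE => /set2P[//|E].
  by case/eqP: z1; apply: (@lmulI _ Q z); rewrite E lmulx1.
rewrite -zE.
set G2 := quotient_of Q Z; set C2 := center_in _ _.
have cG2 : #|G2| = q.
  by apply/eqP; rewrite -(eqn_pmul2l (isT : 0 < 2)) -cT cTZ cZ2 mulnC.
have G2M := quotient_opG (subxx _) Z1 ZM.
have G2x1 := quotient_op1 (subxx _) Z1 ZM.
have G21x := quotient_1op (subxx _) Z1 ZM.
have G2I := quotient_opI (subxx _) Z1 ZM.
have E2 := quotient_mem Q Z one.
have C2M : {in C2 &, forall A B, coset_mul Q A B \in C2}.
  by move=> A B; apply: center_inM.
have C21 : lcoset_of Q one Z \in C2 by apply: center_in1.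
have dC2 : #|C2| %| #|G2| by apply: (central_subset_dvdn G2M) C21 C2M.
have C2G : C2 \subset G2 by apply/subsetP => A /center_inP[].
apply/eqP; rewrite eqEcard C2G cG2.
rewrite cG2 in dC2; rewrite (prime_nt_dvdP q_pr _ dC2) ?leqnn //.
(* The center of the quotient has order 1 or q. Order 1 is excluded because the upper central series
   would then stall at the center. *)
apply/cards1P => -[A C2A].
have {A C2A} C2E : C2 = [set lcoset_of Q one Z] by move: C21; rewrite C2A => /set1P->.
case: n nilQ => [|n] nilQ.
  by case/negP: Zn1; rewrite [X in _ == X]nilQ eqEsubset subsetT -nilQ sub1set Z1.
have := upper_central_fix (Q := Q) (i := 1) n.
have -> : upper_central Q 2 = [set x | lcoset_of Q x Z \in C2].
  by rewrite /C2 /G2 -upper_central1.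
rewrite upper_central1.
have -> : [set x | lcoset_of Q x Z \in C2] = Z.
  apply/setP => x; rewrite in_set C2E in_set1 eq_sym.
  apply/(lcoset_eqP (subxx _) Z1 ZM)/idP => [[k Zk ->]|Zx]; first by rewrite lmul1x.
  by exists x; rewrite ?lmul1x.
move=> /(_ erefl) ZE.
by case/eqP: ZT; rewrite -ZE addn1 nilQ.
Qed.

Local Open Scope ring_scope.

(** The quotient by the central involution z is identified with F_q. A section s of the projection F
    is chosen, and c records whether [s x ∘ s y] differs from [s (x + y)] by the factor z. *)
Lemma nilpotent_extension (q : nat) : prime q -> odd q ->
  #|T| = (2 * q)%N -> nilpotent_loop Q ->
  exists (c : 'F_q -> 'F_q -> bool) (g : 'F_q * bool -> T),
   [/\ normalized c, bijective g & forall u v, g (extmul c u v) = g u ∘ g v].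
Proof.
move=> q_pr q_odd cT nilQ.
have [z [Zz z1 zz CK]] := nilpotent_central_involution q_pr q_odd cT nilQ.
set K := [set one; z] in CK.
have KC : K \subset Z by apply/subsetP => x /set2P[]->; rewrite ?lcenter1.
have K1 : one \in K by rewrite set21.
have KM : {in K &, forall x y, x ∘ y \in K}.
  by move=> x y /set2P[]-> /set2P[]->; rewrite ?zz ?lmulx1 ?lmul1x ?set21 ?set22.
have cG : #|quotient_of Q K| = q.
  have := card_quotient KC K1 KM; rewrite cT cards2 eq_sym z1 mulnC => /eqP.
  by rewrite eqn_pmul2r // => /eqP.
have [f [fM fI]] := prime_order_hom (quotient_opG KC K1 KM) (quotient_mem Q K one)
  (quotient_op1 KC K1 KM) (quotient_1op KC K1 KM) (quotient_opI KC K1 KM) q_pr cG CK.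
pose F x := f (lcoset_of Q x K).
have FM x y : F (x ∘ y) = F x + F y.
  by rewrite /F -(coset_mulE_central KC K1 KM) fM ?quotient_mem.
have F1 : F one = 0 by apply: (addrI (F one)); rewrite -FM lmulx1 addr0.
have Fz : F z = 0.
  rewrite -F1 /F; congr f; apply/esym/eqP/(lcoset_eqP KC K1 KM).
  by exists z; rewrite ?lmul1x ?set22.
have FI x y : F x = F y -> x = y \/ x = y ∘ z.
  move=> E; have /esym/eqP/(lcoset_eqP KC K1 KM) := fI _ _ (quotient_mem _ _ _) (quotient_mem _ _ _) E.
  by case=> n /set2P[]-> ->; [left; rewrite lmulx1 | right].
have Fonto i : exists x, F x == i.
  have /eqP E : f @: quotient_of Q K == setT.
    by rewrite eqEcard subsetT cardsT card_Fp // card_in_imset // cG leqnn.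
  by have := in_setT i; rewrite -E => /imsetP[_ /quotientP[x ->] ->]; exists x.
(* The section sends 0 to the neutral element, which is what makes c normalized. *)
pose s i := if i == 0 then one else xchoose (Fonto i).
have Fs i : F (s i) = i.
  by rewrite /s; case: eqP => [->//|_]; apply/eqP/(xchooseP (Fonto i)).
have s0 : s 0 = one by rewrite /s eqxx.
pose pz (a : bool) := if a then z else one.
have Zpz a : pz a \in Z by case: a; rewrite ?lcenter1.
have Fpz a : F (pz a) = 0 by case: a.
have pzD a b : pz (a (+) b) = pz a ∘ pz b.
  by case: a; case: b; rewrite /= ?zz ?lmulx1 ?lmul1x.
pose c x y := s x ∘ s y != s (x + y).
have cE x y : s x ∘ s y = s (x + y) ∘ pz (c x y).
  rewrite /c; case: eqP => [->|ne] /=; first by rewrite lmulx1.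
  have E : F (s x ∘ s y) = F (s (x + y)) by rewrite FM !Fs.
  by case: (FI _ _ E).
pose g (u : 'F_q * bool) := s u.1 ∘ pz u.2.
exists c, g; split.
- by move=> x; rewrite /c s0 lmulx1 lmul1x addr0 add0r eqxx.
- apply: inj_card_bij.
    move=> [x a] [y b]; rewrite /g /= => E.
    have Exy : x = y by have := congr1 F E; rewrite !FM !Fs !Fpz !addr0.
    move: E; rewrite Exy => /lmulI.
    by case: a b => [] [] //= E; case/eqP: z1; rewrite E.
  by rewrite card_prod card_bool card_Fp // cT mulnC.
- move=> [x a] [y b]; rewrite /g /= addbC addbA !pzD.
  rewrite -(lcenterAr (s x ∘ pz a) (s y) (Zpz b)) (lcenterAm (s x) (s y) (Zpz a)).
  by rewrite (lcenterC (s y) (Zpz a)) -(lcenterAr (s x) _ (Zpz a)) cE -!(lcenterAr _ _ (Zpz _)).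
Qed.

End Classification.

Local Open Scope ring_scope.

(** * Isotopisms between extensions *)

Definition norm_cocycle (q : nat) (c : 'F_q -> 'F_q -> bool) x y :=
  c x y (+) c x 0 (+) c 0 y (+) c 0 0.

Definition affine_pullback (q : nat) (r s t : 'F_q) (d : 'F_q -> 'F_q -> bool) x y :=
  d (r * x + s) (r * y + t).

Definition coboundary (q : nat) (tau : 'F_q -> bool) x y :=
  tau x (+) tau y (+) tau (x + y).

(** The hypotheses are the isotopism relation at [(x, 0)], [(0, y)] and [(0, 0)]; they eliminate the
    components of the first two maps of the triple. *)
Lemma addb_isotopism (pxy px0 p0y p00 ux u0 vy v0 wx wy w0 wxy : bool) :
    false = px0 (+) ux (+) v0 (+) wx -> false = p0y (+) u0 (+) vy (+) wy ->
    false = p00 (+) u0 (+) v0 (+) w0 ->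
  pxy (+) ux (+) vy (+) wxy = pxy (+) px0 (+) p0y (+) p00 (+)
    (wx (+) w0 (+) (wy (+) w0) (+) (wxy (+) w0)).
Proof.
move: px0 ux v0 wx => [] [] [] [] // _; move: p0y u0 vy wy => [] [] [] [] // _;
by move: p00 w0 => [] [] // _; move: pxy wxy => [] [].
Qed.

Lemma addb_coboundary (pxy px0 p0y p00 tx ty txy a b : bool) :
  a (+) (tx (+) px0) (+) (b (+) (ty (+) p0y (+) p00)) (+) pxy =
  a (+) b (+) (pxy (+) px0 (+) p0y (+) p00 (+) (tx (+) ty (+) txy)) (+) txy.
Proof.
by move: pxy px0 p0y => [] [] []; move: p00 tx ty => [] [] []; move: txy a b => [] [] [].
Qed.

Section ExtensionLoops.
Variable q : nat.
Hypotheses (q_pr : prime q) (q_odd : odd q).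
Notation F := 'F_q.
Implicit Types (c d : F -> F -> bool).

Lemma norm_cocycle_normalized c : normalized (norm_cocycle c).
Proof.
by move=> x; rewrite /norm_cocycle; split; case: (c x 0) (c 0 x) (c 0 0) => [] [] [].
Qed.

Lemma norm_cocycle_id c x y : normalized c -> norm_cocycle c x y = c x y.
Proof.
by move=> nc; rewrite /norm_cocycle !(proj1 (nc _), proj2 (nc _)) !addbF.
Qed.

Lemma card_ext : #|{: F * bool}| = (2 * q)%N.
Proof. by rewrite card_prod card_bool card_Fp // mulnC. Qed.

Definition enc (u : F * bool) : 'I_(2 * q) := cast_ord card_ext (enum_rank u).
Definition dec (i : 'I_(2 * q)) : F * bool := enum_val (cast_ord (esym card_ext) i).

Lemma encK : cancel enc dec.
Proof. by move=> u; rewrite /enc /dec cast_ordK enum_rankK. Qed.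
Lemma decK : cancel dec enc.
Proof. by move=> u; rewrite /enc /dec enum_valK cast_ordKV. Qed.
Lemma enc_bij : bijective enc. Proof. by exists dec; [apply: encK | apply: decK]. Qed.
Lemma dec_bij : bijective dec. Proof. by exists enc; [apply: decK | apply: encK]. Qed.

Lemma ext_is_loop c : normalized c ->
  is_loop (fun i j => [ffun p => enc (extmul c (dec p.1) (dec p.2))] (i, j))
    (enc (0, false)).
Proof.
move=> nc; split=> [i|i|i j|i j].
- rewrite ffunE /= encK /extmul /= add0r (proj2 (nc _)) addbF.
  by rewrite -surjective_pairing decK.
- rewrite ffunE /= encK /extmul /= addr0 (proj1 (nc _)) !addbF.
  by rewrite -surjective_pairing decK.
- pose x := (dec j).1 - (dec i).1.
  exists (enc (x, (dec i).2 (+) (dec j).2 (+) c (dec i).1 x)); split.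
    rewrite ffunE /= encK /extmul /= -[RHS]decK [dec j]surjective_pairing.
    by rewrite addrC /x subrK addbA addbK addbA addbb.
  move=> k; rewrite ffunE /= => E; rewrite -[RHS]decK; congr enc.
  rewrite /x -E encK /extmul /= addrC addKr.
  by case: (dec k) => y b /=; congr pair; case: (dec i).2 b (c _ _) => [] [] [].
- pose x := (dec j).1 - (dec i).1.
  exists (enc (x, (dec i).2 (+) (dec j).2 (+) c x (dec i).1)); split.
    rewrite ffunE /= encK /extmul /= -[RHS]decK [dec j]surjective_pairing.
    by rewrite /x subrK; congr (enc (_, _)); case: (dec i).2 (dec j).2 (c _ _) => [] [] [].
  move=> k; rewrite ffunE /= => E; rewrite -[RHS]decK; congr enc.
  rewrite /x -E encK /extmul /= addrK.
  by case: (dec k) => y b /=; congr pair; case: (dec i).2 b (c _ _) => [] [] [].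
Qed.

(** Normalizing first makes every function c yield a loop, so no proof about c is carried;
    normalized cocycles are unchanged by it. *)
Definition extloop c : loop 'I_(2 * q) :=
  @Loop _ ([ffun p => enc (extmul (norm_cocycle c) (dec p.1) (dec p.2))], enc (0, false))
    (introT (asboolP _) (ext_is_loop (norm_cocycle_normalized c))).

Lemma lmul_ext c u v :
  lmul (extloop c) (enc u) (enc v) = enc (extmul (norm_cocycle c) u v).
Proof. by rewrite /lmul /= ffunE /= !encK. Qed.

(** The first coordinate is a homomorphism to F, and its kernel is central because the normalized
    cocycle vanishes on the axes. *)
Lemma extloop_nilpotent c : nilpotent_loop (extloop c).
Proof.
pose f i : F := (dec i).1.
apply: (@nilpotent_hom _ _ _ f) => [i j|k fk].
  by rewrite -(decK i) -(decK j) lmul_ext /f !encK.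
have nc := norm_cocycle_normalized c.
apply/lcenterP => i j; rewrite -(decK i) -(decK j) -(decK k) !lmul_ext.
move: fk; rewrite /f; case: (dec k) => z a /= ->; case: (dec i) => x b; case: (dec j) => y e.
rewrite /extmul /=; set n := norm_cocycle c in nc *.
rewrite !(proj1 (nc _), proj2 (nc _), addr0, add0r, addbF).
by split; congr (enc (_, _)); case: a b e (n x y) => [] [] [] [].
Qed.

Lemma nilpotent_isomorphic_ext (Q : loop 'I_(2 * q)) : nilpotent_loop Q ->
  exists2 c, normalized c & isomorphic (extloop c) Q.
Proof.
move=> nQ; have [|c [g [nc gbij gM]]] := nilpotent_extension q_pr q_odd _ nQ.
  by rewrite card_ord.
exists c => //; exists (g \o dec); first exact: bij_comp dec_bij.
move=> i j; rewrite -(decK i) -(decK j) lmul_ext /= !encK -gM /extmul.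
by rewrite norm_cocycle_id.
Qed.

Lemma additive_Fp (phi : F -> F) :
  (forall x y, phi (x + y) = phi x + phi y) -> forall x, phi x = phi 1 * x.
Proof.
move=> phiD x; rewrite -(natr_Zp x); elim: (x : nat) => [|n IHn].
  by rewrite mulr0; apply: (addrI (phi 0)); rewrite -phiD !addr0.
by rewrite -natr1 phiD IHn mulrDr mulr1.
Qed.

(** For a normalized cocycle this is multiplication by the central involution [(0, true)]; it
    exchanges the two points of a fibre over F. *)
Definition flip (u : F * bool) := (u.1, ~~ u.2).

Lemma flipK : involutive flip.
Proof. by case=> x a; rewrite /flip /= negbK. Qed.

Lemma eq_fst_flip (u v : F * bool) : u.1 = v.1 -> u <> v -> u = flip v.
Proof. by case: u v => x a [y b] /= -> ; case: a b => [] []. Qed.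

Lemma extmul_flipl c u v : extmul c (flip u) v = flip (extmul c u v).
Proof. by rewrite /extmul /flip /= !addNb. Qed.

Lemma extmul_flipr c u v : extmul c u (flip v) = flip (extmul c u v).
Proof. by rewrite /extmul /flip /= addbN addNb. Qed.

Lemma addrr_Fp (x : F) : x + x = 0 -> x = 0.
Proof.
move=> x2; apply/eqP; have: x *+ 2 == 0 by rewrite mulr2n x2.
rewrite -mulr_natr mulf_eq0 -(dvdn_pcharf (pchar_Fp q_pr)) => /orP[//|/(@dvdn_leq _ 2 isT)].
by rewrite leqNgt odd_prime_gt2.
Qed.

(** Commuting with [flip], the three maps descend to maps of F with [a1 x + b1 y = g1 (x + y)], so
    all are affine with one slope r. The second components u, v, w satisfy a relation between c and
    d; eliminating u and v by its instances on the axes leaves the normalized pullback plus a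
    coboundary made from w. *)
Lemma ext_isotopism_param c d (al be ga : F * bool -> F * bool) :
    normalized c -> injective al -> injective be -> injective ga ->
    (forall u v, extmul d (al u) (be v) = ga (extmul c u v)) ->
  exists r tau, let s := (al (0, false)).1 in let t := (be (0, false)).1 in
   [/\ r != 0, tau 0 = false & forall x y, c x y =
     norm_cocycle (affine_pullback r s t d) x y (+) coboundary tau x y].
Proof.
move=> nc alI beI gaI E.
(* A + B = A' + B' and A' + B = A + B' for the first components, whence
   2 (A - A') = 0: the isotopism respects the fibres over F. *)
have fl u v : (al (flip u)).1 = (al u).1 /\ (be (flip v)).1 = (be v).1.
  have e1 := congr1 fst (E (flip u) v); have e2 := congr1 fst (E u (flip v)).
  have e3 := congr1 fst (E u v); have e4 := congr1 fst (E (flip u) (flip v)).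
  move: e1 e2 e3 e4; rewrite !(extmul_flipl, extmul_flipr) flipK /=.
  set A := (al u).1; set A' := (al (flip u)).1.
  set B := (be v).1; set B' := (be (flip v)).1.
  move=> e1 e2 e3 e4.
  have eA : A' = A.
    apply/eqP; rewrite -subr_eq0; apply/eqP/addrr_Fp.
    have -> : A' - A + (A' - A) = (A' + B) + (A' + B') - ((A + B) + (A + B')).
      by ring.
    by rewrite e1 e2 e3 e4 (addrC (ga _).1) subrr.
  by split=> //; move: e1; rewrite eA -e2 => /addrI.
have alF u : al (flip u) = flip (al u).
  apply: eq_fst_flip; first by have [] := fl u u.
  by move/alI; case: u => x [].
have beF u : be (flip u) = flip (be u).
  apply: eq_fst_flip; first by have [] := fl u u.
  by move/beI; case: u => x [].
(* Since [(0, false)] is neutral, every u is a product, and [ga] inherits the property from [al]. *)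
have gaF u : ga (flip u) = flip (ga u).
  have u0 : u = extmul c u (0, false).
    by case: (u) => x a; rewrite /extmul /= addr0 (proj1 (nc _)) !addbF.
  by rewrite u0 -extmul_flipl -!E alF extmul_flipl.
have flE (f : F * bool -> F * bool) : (forall u, f (flip u) = flip (f u)) ->
    forall x a, f (x, a) = ((f (x, false)).1, a (+) (f (x, false)).2).
  move=> fF x [] /=; last by rewrite -surjective_pairing.
  by rewrite -[(x, true)]/(flip (x, false)) fF.
pose a1 x := (al (x, false)).1; pose u x := (al (x, false)).2.
pose b1 x := (be (x, false)).1; pose v x := (be (x, false)).2.
pose g1 x := (ga (x, false)).1; pose w x := (ga (x, false)).2.
have E' x y : a1 x + b1 y = g1 (x + y) /\
    c x y = d (a1 x) (b1 y) (+) u x (+) v y (+) w (x + y).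
  have := E (x, false) (y, false).
  rewrite {2}/extmul /= (flE ga gaF) /extmul => -[-> e2]; split=> //.
  move: e2; rewrite -/(u x) -/(v y) -/(a1 x) -/(b1 y) -/(w (x + y)) /=.
  by case: (u x) (v y) (w _) (d _ _) (c x y) => [] [] [] [] [].
pose s := a1 0; pose t := b1 0; pose phi x := g1 x - s - t.
have a1E x : a1 x = phi x + s by rewrite /phi -{2}[x]addr0; have [<- _] := E' x 0; rewrite -/t; ring.
have b1E x : b1 x = phi x + t by rewrite /phi -{2}[x]add0r; have [<- _] := E' 0 x; rewrite -/s; ring.
have phiD x y : phi (x + y) = phi x + phi y.
  by rewrite {1}/phi; have [<- _] := E' x y; rewrite a1E b1E; ring.
have [r phiE] : exists r, forall x, phi x = r * x.
  by exists (phi 1); apply: additive_Fp.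
(* Adding [w 0] gives [tau 0 = false], without which the coboundary would not vanish on the axes. *)
exists r, (fun x => w x (+) w 0); rewrite -/s -/t -[(al _).1]/s -[(be _).1]/t /=; split.
(* With slope 0 the images of [(1, false)] and [(0, false)] lie in one fibre and differ by a flip;
   injectivity then puts the two points themselves in one fibre, so [1 = 0]. *)
- apply/eqP => r0.
  have e : (al (1, false)).1 = (al (0, false)).1.
    by rewrite -/(a1 1) -/(a1 0) !a1E !phiE r0 !mul0r.
  have ne : al (1, false) <> al (0, false) by move=> /alI[/eqP]; rewrite oner_eq0.
  have := eq_fst_flip e ne; rewrite -alF => /alI[/eqP]; by rewrite oner_eq0.
- exact: addbb.
move=> x y.
have D x' y' : d (a1 x') (b1 y') = affine_pullback r s t d x' y'.
  by rewrite a1E b1E !phiE.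
have [_ exy] := E' x y; have [_ ex0] := E' x 0; have [_ e0y] := E' 0 y.
have [_ e00] := E' 0 0.
move: exy ex0 e0y e00; rewrite !D !(proj1 (nc _), proj2 (nc _)) !(addr0, add0r) => ->.
exact: addb_isotopism.
Qed.

Lemma ext_isotopism c d r s t tau : r != 0 ->
    (forall x y, c x y =
       norm_cocycle (affine_pullback r s t d) x y (+) coboundary tau x y) ->
  exists al be ga : F * bool -> F * bool, [/\ injective al, injective be, injective ga,
    forall u v, extmul d (al u) (be v) = ga (extmul c u v)
    & normalized d -> s = 0 -> t = 0 -> al = ga /\ be = ga].
Proof.
move=> r0 cE; set D := affine_pullback r s t d in cE.
pose mk (b : F) (u : F -> bool) (p : F * bool) := (r * p.1 + b, p.2 (+) u p.1).
have mkI b u : injective (mk b u).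
  move=> [x a] [y e] E; move: (congr1 fst E) (congr1 snd E) => /=.
  by move=> /addIr/(mulfI r0)-> /addIb->.
exists (mk s (fun x => tau x (+) D x 0)), (mk t (fun y => tau y (+) D 0 y (+) D 0 0)).
exists (mk (s + t) tau); split; try exact: mkI.
  move=> [x a] [y b]; rewrite /extmul /mk /=; congr pair; first by ring.
  by rewrite cE -/(D x y); apply: addb_coboundary.
move=> nd s0 t0.
have D0 x : D x 0 = false /\ D 0 x = false.
  by rewrite /D /affine_pullback s0 t0 !addr0 mulr0.
by split; apply/funext => -[x a]; rewrite /mk /= s0 t0 !addr0
  !(proj1 (D0 _), proj2 (D0 _)) !addbF.
Qed.

End ExtensionLoops.

(** * Counting classes *)

Local Close Scope ring_scope.

Section IsotopyRelation.
Variable T : finType.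

Lemma isomorphic_isotopic (T' : finType) (Q : loop T) (Q' : loop T') :
  isomorphic Q Q' -> isotopic Q Q'.
Proof. by case=> f fb fM; exists f, f, f; split. Qed.

Lemma isotopic_equiv : equivalence_rel (fun P Q : loop T => `[< isotopic P Q >]).
Proof.
have refl Q : isotopic Q Q by exists id, id, id; split=> //; exists id.
have sym P Q : isotopic P Q -> isotopic Q P.
  move=> [a [b [c [[a' aK Ka] [b' bK Kb] [c' cK Kc] M]]]].
  exists a', b', c'; split; [by exists a | by exists b | by exists c |].
  by move=> x y; apply: (can_inj cK); rewrite -M Ka Kb Kc.
have trans P Q S : isotopic P Q -> isotopic Q S -> isotopic P S.
  move=> [a [b [c [ab bb cb M]]]] [a' [b' [c' [ab' bb' cb' M']]]].
  exists (a' \o a), (b' \o b), (c' \o c); split; try exact: bij_comp.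
  by move=> x y /=; rewrite M' M.
move=> P Q S; split; first exact/asboolP.
by move=> /asboolP PQ; apply/asboolP/asboolP => H; apply: trans H => //; apply: sym.
Qed.

Lemma isomorphic_equiv : equivalence_rel (fun P Q : loop T => `[< isomorphic P Q >]).
Proof.
have refl Q : isomorphic Q Q by exists id => //; exists id.
have sym P Q : isomorphic P Q -> isomorphic Q P.
  move=> [a [a' aK Ka] M]; exists a'; first by exists a.
  by move=> x y; apply: (can_inj aK); rewrite M !Ka.
have trans P Q S : isomorphic P Q -> isomorphic Q S -> isomorphic P S.
  move=> [a ab M] [a' ab' M']; exists (a' \o a); first exact: bij_comp.
  by move=> x y /=; rewrite M M'.
move=> P Q S; split; first exact/asboolP.
by move=> /asboolP PQ; apply/asboolP/asboolP => H; apply: trans H => //; apply: sym.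
Qed.

End IsotopyRelation.

Section ClassCount.
Variables (L Y PT : finType) (R : rel L) (D : {set L}) (Phi : Y -> L).
Variables (X NG : {set Y}) (P : {set PT}) (act : PT -> Y -> Y).
Hypotheses (eqR : equivalence_rel R) (PhiD : {in X, forall y, Phi y \in D})
  (PhiR : {in D, forall l, exists2 y, y \in X & R l (Phi y)})
  (actR : {in X &, forall x y, R (Phi x) (Phi y) = (x \in [set act p y | p in P])})
  (actX : {in P & X, forall p y, act p y \in X})
  (actI : {in X, forall y, y \notin NG -> {in P &, injective (act^~ y)}})
  (NGX : NG \subset X).

(** The points of X whose image lies in a given class form one set of images of a single y0 under P.
    It has at most [#|P|] elements, and exactly that many if y0 is outside NG; otherwise the class
    is charged [#|P|] through a point of NG. Summing over the classes gives both bounds. *)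
Lemma class_count :
  #|X| <= #|equivalence_partition R D| * #|P| <= #|X| + #|P| * #|NG|.
Proof.
set C := equivalence_partition R D.
have eqD : {in D & &, equivalence_rel R} by move=> x y z _ _ _; apply: eqR.
have pC : partition C D := equivalence_partitionP eqD.
have [/eqP covC triC _] := and3P pC.
pose blk y := pblock C (Phi y).
have blkC y : y \in X -> blk y \in C.
  by move=> Xy; rewrite /blk pblock_mem // covC PhiD.
have cnt (E : {set Y}) : E \subset X ->
    #|E| = \sum_(B in C) #|[set y in E | blk y == B]|.
  move=> /subsetP EX; rewrite -sum1_card (partition_big blk (mem C)) /=; last first.
    by move=> y /EX; apply: blkC.
  by apply: eq_bigr => B _; rewrite -sum1_card; apply: eq_bigl => y; rewrite inE.
have fib B : B \in C -> exists2 y0, y0 \in X &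
    [set y in X | blk y == B] = [set act p y0 | p in P] /\ blk y0 = B.
  move=> CB.
  have [l Bl] : exists l, l \in B.
    by apply/set0Pn; apply: contraTneq CB => ->; have [] := and3P pC.
  have Dl : l \in D by rewrite -covC; apply/bigcupP; exists B.
  have BE : B = pblock C l by rewrite (def_pblock triC CB Bl).
  have [y0 Xy0 Rl] := PhiR Dl; exists y0 => //.
  have By0 : blk y0 = B.
    rewrite BE; apply/esym/eqP; rewrite eq_pblock ?covC //.
    by rewrite pblock_equivalence_partition // PhiD.
  split=> //; apply/setP => y; rewrite inE; apply/andP/idP => [[Xy /eqP yB]|].
    rewrite -actR // -(pblock_equivalence_partition eqD) ?PhiD //.
    by rewrite -eq_pblock ?covC ?PhiD // -/(blk y) -/(blk y0) yB By0.
  move=> yP; have Xy : y \in X by case/imsetP: yP => p Pp ->; apply: actX.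
  split=> //; rewrite -By0 eq_pblock ?covC ?PhiD //.
  by rewrite pblock_equivalence_partition ?PhiD // actR.
rewrite (cnt X (subxx _)) (cnt NG NGX) big_distrr /= -big_split /= -sum_nat_const.
apply/andP; split; apply: leq_sum => B CB; have [y0 Xy0 [E By0]] := fib B CB.
  by rewrite E leq_imset_card.
rewrite E; have [NGy0|gy0] := boolP (y0 \in NG).
  apply: leq_trans (leq_addl _ _); rewrite leq_pmulr //.
  by apply/card_gt0P; exists y0; rewrite inE NGy0 By0 /=.
by rewrite card_in_imset ?leq_addr //; apply: actI.
Qed.

End ClassCount.

(** * Sparse sets and counting under a twisted invariance *)

Lemma sparse_set (U : finType) (phi : U -> U) : injective phi ->
  (forall x y, phi x = x -> phi y = y -> x = y) ->
  exists2 A : {set U}, {in A, forall x, phi x \notin A} & #|U| <= (3 * #|A|).+1.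
Proof.
move=> phiI fix1.
pose ok (A : {set U}) := [forall x in A, phi x \notin A].
have ok0 : ok set0 by apply/forall_inP => x; rewrite inE.
(* For a maximal such A, every non-fixed x is in A, phi^-1 A or phi A. *)
have [A mA _] := maxset_exists ok0.
have /maxsetP[okA Amax] := mA.
have phiA x : x \in A -> phi x \notin A by move=> Ax; apply: (forall_inP okA).
exists A => //.
pose Fx := [set x | phi x == x].
have cF : #|Fx| <= 1.
  apply/card_le1_eqP => x y; rewrite !inE => /eqP ex /eqP ey; exact: fix1.
have : setT \subset A :|: (phi @^-1: A) :|: [set phi x | x in A] :|: Fx.
  apply/subsetP => x _; rewrite !inE; apply/negPn; rewrite !negb_or.
  apply/negP => /andP[/andP[/andP[nA nphiA] nimA] nfix].
  have okxA : ok (x |: A).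
    apply/forall_inP => y /setU1P[->|Ay]; rewrite !inE negb_or.
      by rewrite nfix nphiA.
    rewrite (phiA _ Ay) andbT; apply: contra nimA => /eqP <-; exact: imset_f.
  by move: nA; rewrite -(Amax _ okxA (subsetUr _ _)) setU11.
move=> /subset_leq_card; rewrite cardsT => /leq_trans; apply.
have cU (B1 B2 : {set U}) : #|B1 :|: B2| <= #|B1| + #|B2| by rewrite cardsU leq_subr.
apply: leq_trans (cU _ _) _; rewrite -addn1 leq_add //.
apply: leq_trans (cU _ _) _; rewrite mulSn mul2n -addnn addnA leq_add ?leq_imset_card //.
apply: leq_trans (cU _ _) _; rewrite leq_add2l.
by rewrite card_preimset.
Qed.

(** A member of B is determined by the index i and its part outside S: for x in S the point [k x]
    lies outside S and decides whether x belongs. *)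
Lemma twisted_count (U I : finType) (S : {set U}) (k : U -> U) (f : I -> U -> bool)
    (B : {set {set U}}) : {in S, forall x, k x \notin S} ->
  {in B, forall th : {set U}, exists i, {in S, forall x, (x \in th) = (k x \in th) (+) f i x}} ->
  #|B| <= #|I| * 2 ^ (#|U| - #|S|).
Proof.
move=> kS BP.
pose g (z : I * {set U}) := z.2 :|: [set x in S | (k x \in z.2) (+) f z.1 x].
have : B \subset g @: setX setT (powerset (~: S)).
  apply/subsetP => th /BP[i iP]; apply/imsetP; exists (i, th :\: S).
    by rewrite !inE /= subsetDr.
  apply/setP => x; rewrite !inE /=; have [Sx|] := boolP (x \in S); last by rewrite orbF.
  by rewrite iP // (kS _ Sx).
move=> /subset_leq_card/leq_trans; apply; apply: leq_trans (leq_imset_card _ _) _.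
by rewrite cardsX cardsT card_powerset cardsCs setCK.
Qed.

Local Open Scope ring_scope.

Lemma addb_agree (a b c e k a' b' c' e' k' : bool) :
  a (+) b (+) c (+) e (+) k = a' (+) b' (+) c' (+) e' (+) k' ->
  a = a' (+) (b (+) b' (+) e (+) e' (+) (c (+) c') (+) (k (+) k')).
Proof.
by case: a; case: a'; case: b; case: b'; case: c; case: c'; case: e; case: e';
  case: k; case: k'.
Qed.

(** * Cocycles as finite sets and the transformations acting on them *)

Section CocycleSets.
Variable q : nat.
Hypotheses (q_pr : prime q) (q_odd : odd q).
Notation F := 'F_q.
Implicit Types (th eta : {set F * F}).

(** Cocycles are encoded by their supports, so that the normalized ones form a powerset. *)
Definition cocycle_fun th (x y : F) : bool := (x, y) \in th.

Definition cocycles : {set {set F * F}} := powerset (setX [set~ 0] [set~ 0]).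

Lemma cocyclesP th : reflect (normalized (cocycle_fun th)) (th \in cocycles).
Proof.
rewrite powersetE; apply: (iffP subsetP) => [H x|H [x y] thxy].
  by split; apply/negP => /H; rewrite !inE /= ?eqxx ?andbF.
rewrite !inE /=; apply/andP; split; apply: contraTneq thxy => ->.
  by have [_] := H y; rewrite /cocycle_fun => ->.
by have [] := H x; rewrite /cocycle_fun => ->.
Qed.

Lemma card_cocycles : #|cocycles| = (2 ^ (q.-1 ^ 2))%N.
Proof. by rewrite card_powerset cardsX !cardsC1 card_Fp. Qed.

(** S is the range of the two shifts s and t: all of F for isotopisms, only 0 for isomorphisms. *)
Definition params (S : {set F}) : {set F * F * F * {set F}} :=
  setX (setX (setX [set~ 0] S) S) (powerset [set~ 0]).

Lemma card_params S : #|params S| = (q.-1 * #|S| ^ 2 * 2 ^ q.-1)%N.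
Proof. by rewrite !cardsX card_powerset !cardsC1 card_Fp // -mulnn !mulnA. Qed.

Lemma paramsP (S : {set F}) r s t (tau : {set F}) :
  reflect [/\ r != 0, s \in S, t \in S & 0 \notin tau] ((r, s, t, tau) \in params S).
Proof.
have e : (0 \notin tau) = (tau \subset [set~ 0]) by rewrite -disjoints_subset disjoint_sym disjoints1.
by rewrite e !inE /= -!andbA; apply: and4P.
Qed.

Definition param_act (p : F * F * F * {set F}) th : {set F * F} :=
  let: (r, s, t, tau) := p in
  [set w | norm_cocycle (affine_pullback r s t (cocycle_fun th)) w.1 w.2
             (+) coboundary (fun x => x \in tau) w.1 w.2].

Lemma param_actE r s t tau th x y : cocycle_fun (param_act (r, s, t, tau) th) x y =
  norm_cocycle (affine_pullback r s t (cocycle_fun th)) x y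
    (+) coboundary (fun x => x \in tau) x y.
Proof. by rewrite /cocycle_fun inE. Qed.

Lemma param_act_cocycle S p th : p \in params S -> param_act p th \in cocycles.
Proof.
case: p => [[[r s] t] tau] /paramsP[_ _ _ /negbTE tau0]; apply/cocyclesP => x.
rewrite !param_actE /coboundary !(proj1 (norm_cocycle_normalized _ _),
  proj2 (norm_cocycle_normalized _ _)) addr0 add0r tau0.
by split; case: (x \in tau).
Qed.

Notation extl th := (extloop q_pr (cocycle_fun th)).

Lemma lmul_extl th u v : th \in cocycles ->
  lmul (extl th) (enc q_pr u) (enc q_pr v) = enc q_pr (extmul (cocycle_fun th) u v).
Proof. by move=> /cocyclesP nth; rewrite lmul_ext /extmul norm_cocycle_id. Qed.

Lemma isotopic_extP th eta : th \in cocycles -> eta \in cocycles ->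
  isotopic (extl th) (extl eta) <-> th \in [set param_act p eta | p in params setT].
Proof.
move=> Xth Xeta; split.
  move=> [a [b [g [/bij_inj aI /bij_inj bI /bij_inj gI M]]]].
  have cI f : injective f -> injective (dec q_pr \o f \o enc q_pr).
    by move=> fI; apply: inj_comp (can_inj (@encK _ q_pr)); apply: inj_comp fI; apply: can_inj (@decK _ q_pr).
  have := ext_isotopism_param q_pr q_odd (c := cocycle_fun th) (d := cocycle_fun eta)
   (elimT (cocyclesP _) Xth) (cI _ aI) (cI _ bI) (cI _ gI).
  case=> [u v|r [tau]] /=.
    by apply: (can_inj (@encK _ q_pr)); rewrite -!lmul_extl // !decK -M.
  set s := (dec _ _).1; set t := (dec _ _).1 => -[r0 tau0 E].
  apply/imsetP; exists (r, s, t, [set x | tau x]).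
    by apply/paramsP; split; rewrite ?inE ?tau0.
  apply/setP => -[x y]; rewrite -!/(cocycle_fun _ x y) param_actE E.
  by rewrite /coboundary !inE.
move=> /imsetP[[[[r s] t] tau] /paramsP[r0 _ _ tau0] E].
have E' := param_actE r s t tau eta; rewrite -E in E'.
have [a [b [g [aI bI gI M _]]]] := ext_isotopism r0 E'.
have cb f : injective f -> bijective (enc q_pr \o f \o dec q_pr).
  by move=> fI; apply: bij_comp (dec_bij q_pr); apply: bij_comp (enc_bij q_pr) (injF_bij fI).
exists (enc q_pr \o a \o dec q_pr), (enc q_pr \o b \o dec q_pr), (enc q_pr \o g \o dec q_pr).
split; try exact: cb.
by move=> i j /=; rewrite -{2}(decK q_pr i) -{2}(decK q_pr j) !lmul_extl // encK M.
Qed.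

Lemma isomorphic_extP th eta : th \in cocycles -> eta \in cocycles ->
  isomorphic (extl th) (extl eta) <-> th \in [set param_act p eta | p in params [set 0]].
Proof.
move=> Xth Xeta; split.
  move=> [a /bij_inj aI M].
  pose f := dec q_pr \o a \o enc q_pr.
  have fI : injective f.
    by apply: inj_comp (can_inj (@encK _ q_pr)); apply: inj_comp aI; apply: can_inj (@decK _ q_pr).
  have fM u v : extmul (cocycle_fun eta) (f u) (f v) = f (extmul (cocycle_fun th) u v).
    by apply: (can_inj (@encK _ q_pr)); rewrite /f /= -!lmul_extl // !decK -M.
  have nth := elimT (cocyclesP _) Xth.
  (* The image of the neutral element is idempotent, so its first component a satisfies [a + a = a].
     Both shifts are therefore 0. *)
  have s0 : (f (0, false)).1 = 0.
    have := congr1 fst (fM (0, false) (0, false)).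
    by rewrite /extmul /= addr0 (proj1 (nth _)) -[X in _ = X]addr0 => /addrI.
  have [r [tau]] := ext_isotopism_param q_pr q_odd nth fI fI fI fM.
  rewrite /= s0 => -[r0 tau0 E].
  apply/imsetP; exists (r, 0, 0, [set x | tau x]).
    by apply/paramsP; split; rewrite ?inE ?tau0.
  apply/setP => -[x y]; rewrite -!/(cocycle_fun _ x y) param_actE E.
  by rewrite /coboundary !inE.
move=> /imsetP[[[[r s] t] tau] /paramsP[r0 /set1P s0 /set1P t0 tau0] E].
have E' := param_actE r s t tau eta; rewrite -E in E'.
have [a [b [g [aI bI gI M eqg]]]] := ext_isotopism r0 E'.
have [ea eb] := eqg (elimT (cocyclesP _) Xeta) s0 t0.
exists (enc q_pr \o g \o dec q_pr).
  by apply: bij_comp (dec_bij q_pr); apply: bij_comp (enc_bij q_pr) (injF_bij gI).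
move=> i j /=; rewrite -{1}(decK q_pr i) -{1}(decK q_pr j) !lmul_extl // encK.
by rewrite -M ea eb.
Qed.

(** Since 2 is invertible, the coboundary at [(x / 2, x / 2)] is [tau x]: the first two terms
    cancel. *)
Lemma coboundary_inj (tau tau' : {set F}) :
  (forall x y, coboundary (fun x => x \in tau) x y = coboundary (fun x => x \in tau') x y) ->
  tau = tau'.
Proof.
move=> E; apply/setP => x.
have two0 : (2%:R : F) != 0.
  by apply/eqP => t0; have := @addrr_Fp q q_pr q_odd 1; rewrite -mulr2n t0 => /(_ erefl)/eqP; rewrite oner_eq0.
have xE : x / 2%:R + x / 2%:R = x by rewrite -mulr2n -(mulr_natr (x / 2%:R) 2) mulfVK.
by have := E (x / 2%:R) (x / 2%:R); rewrite /coboundary xE !addbb.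
Qed.

Definition agree p p' := [set th in cocycles | param_act p th == param_act p' th].

(** The map k carries the point where the first transformation reads [th] to the point where the
    second reads it. Agreement determines [th] at w from [th] at [k w], up to known coboundaries and
    values on the axes. Those values form one function of x and one of y, and choosing both in
    advance costs the factor [2 ^ (2 * q)]. *)
Lemma card_agree_sparse r s t tau r' s' t' tau' (S : {set F * F}) : r != 0 ->
  let k (w : F * F) := (r' * ((w.1 - s) / r) + s', r' * ((w.2 - t) / r) + t') in
  {in S, forall w, k w \notin S} ->
  (#|agree (r, s, t, tau) (r', s', t', tau')| <= 2 ^ (2 * q) * 2 ^ (q * q - #|S|))%N.
Proof.
move=> r0 k kS.
pose K x y := coboundary (fun x => x \in tau) x y (+) coboundary (fun x => x \in tau') x y.
pose f (UV : {set F} * {set F}) (w : F * F) :=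
  let x := (w.1 - s) / r in let y := (w.2 - t) / r in
  (x \in UV.1) (+) (y \in UV.2) (+) K x y.
have -> : (2 ^ (2 * q))%N = #|{: {set F} * {set F}}|.
  by rewrite card_prod -!cardsT -!powersetT !card_powerset cardsT card_Fp // mul2n -addnn expnD.
have -> : (q * q)%N = #|{: F * F}| by rewrite card_prod card_Fp.
apply: (twisted_count (k := k) (f := f)) => // th; rewrite inE => /andP[_ /eqP E].
pose D := affine_pullback r s t (cocycle_fun th).
pose D' := affine_pullback r' s' t' (cocycle_fun th).
(* The constant term of the two normalizations is absorbed into the function of x. *)
exists ([set x | D x 0 (+) D' x 0 (+) D 0 0 (+) D' 0 0], [set y | D 0 y (+) D' 0 y]).
move=> [x' y'] _; rewrite /f /= !inE.
set x := _ / r; set y := _ / r.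
have -> : ((x', y') \in th) = D x y.
  by rewrite /D /affine_pullback /cocycle_fun /x /y ![r * _]mulrC !mulfVK // !subrK.
have -> : (k (x', y') \in th) = D' x y by [].
have /setP/(_ (x, y)) := E; rewrite -!/(cocycle_fun _ x y) !param_actE /K /norm_cocycle.
exact: addb_agree.
Qed.
End CocycleSets.

(** * Generic cocycles and bounds for the number of classes *)

Section Counting.
Variable q : nat.
Hypotheses (q_pr : prime q) (q_odd : odd q).
Notation F := 'F_q.

(** The transition between two distinct affine maps fixes at most one point, so [sparse_set] applies
    and gives [q <= 3 * #|A| + 1]. *)
Lemma affine_sparse (r s r' s' : F) : r != 0 -> r' != 0 -> (r, s) != (r', s') ->
  exists2 A : {set F}, {in A, forall x, r' * ((x - s) / r) + s' \notin A}
    & (q.-1 %/ 3 <= #|A|)%N.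
Proof.
move=> r0 r'0 ne; pose phi (x : F) : F := r' * ((x - s) / r) + s'.
have phiI : injective phi by move=> x y /addIr/(mulfI r'0)/divIf/addIr; apply.
have [|A phiA cA] := sparse_set phiI; last first.
  exists A => //; move: cA; rewrite card_Fp //; move: #|A| => n cA; lia.
have fixE x : phi x = x -> (r' - r) * ((x - s) / r) = s - s'.
  move=> e; rewrite mulrBl [r * _]mulrC mulfVK // -[X in _ - (X - _)]e /phi.
  by ring.
move=> x y /fixE ex /fixE ey; have rr : r' - r != 0.
  apply: contraNneq ne => rr; move: ex; rewrite rr mul0r => /esym/eqP.
  by rewrite subr_eq0 => /eqP->; move/eqP: rr; rewrite subr_eq0 => /eqP->.
by move: ex; rewrite -ey => /(mulfI rr)/divIf/addIr; apply.
Qed.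

Let m := (q.-1 %/ 3)%N.

(** If the affine maps differ in the first or in the second variable, a sparse set for that variable
    times all of F is sparse for the transition map on pairs. If only the [tau] differ, the two
    transformations never agree, by [coboundary_inj]. *)
Lemma card_agree (p p' : F * F * F * {set F}) : p \in params setT -> p' \in params setT -> p != p' ->
  (#|agree p p'| <= 2 ^ (2 * q) * 2 ^ (q * q - m * q))%N.
Proof.
case: p => [[[r s] t] tau]; case: p' => [[[r' s'] t'] tau'].
move=> /paramsP[r0 _ _ _] /paramsP[r'0 _ _ _] ne.
have bnd (S : {set F * F}) : (m * q <= #|S|)%N ->
    (2 ^ (2 * q) * 2 ^ (q * q - #|S|) <= 2 ^ (2 * q) * 2 ^ (q * q - m * q))%N.
  by move=> mS; rewrite leq_pmul2l ?expn_gt0 // leq_exp2l // leq_sub2l.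
have [ers|nrs] := eqVneq (r, s) (r', s'); last first.
  have [A HA cA] := affine_sparse r0 r'0 nrs.
  apply: leq_trans (bnd (setX A setT) _); last by rewrite cardsX cardsT card_Fp // leq_mul2r cA orbT.
  apply: card_agree_sparse => // -[x y]; rewrite !inE /= !andbT; exact: HA.
have [ert|nrt] := eqVneq (r, t) (r', t'); last first.
  have [A HA cA] := affine_sparse r0 r'0 nrt.
  apply: leq_trans (bnd (setX setT A) _); last first.
    by rewrite cardsX cardsT card_Fp // mulnC leq_mul2l cA orbT.
  apply: card_agree_sparse => // -[x y]; rewrite !inE /=; exact: HA.
move: (congr1 fst ers) (congr1 snd ers) (congr1 snd ert) => /= er es et.
rewrite (_ : agree _ _ = set0) ?cards0 //; apply/setP => th; rewrite !inE.
apply/negP => /andP[_ /eqP/setP E]; case/eqP: ne; rewrite er es et; congr (_, _).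
apply: (coboundary_inj q_pr q_odd) => x y; have := E (x, y).
by rewrite -!/(cocycle_fun _ x y) !param_actE er es et => /addbI.
Qed.

(** Coincidences are collected over the full family of parameters, so that one exceptional set
    serves both counts. *)
Definition nongeneric : {set {set F * F}} :=
  \bigcup_(pp in setX (params setT) (params setT) | pp.1 != pp.2) agree pp.1 pp.2.

Lemma nongeneric_cocycles : nongeneric \subset cocycles q.
Proof.
apply/subsetP => th /bigcupP[pp _]; by rewrite inE => /andP[].
Qed.

Lemma generic_inj S : {in cocycles q, forall th, th \notin nongeneric ->
  {in params S &, injective ((@param_act q)^~ th)}}.
Proof.
have sub p : p \in params S -> p \in params setT.
  by case: p => [[[r s] t] tau] /paramsP[? _ _ ?]; apply/paramsP; split; rewrite ?inE.
move=> th Xth gen p p' /sub Pp /sub Pp' /= E; apply/eqP; apply: contraNT gen => ne.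
apply/bigcupP; exists (p, p'); first by rewrite in_setX Pp Pp' ne.
by rewrite inE Xth E /=.
Qed.

Lemma card_bigcup_leq (I U : finType) (P : pred I) (A : I -> {set U}) n :
  (forall i, P i -> #|A i| <= n)%N -> (#|\bigcup_(i | P i) A i| <= #|P| * n)%N.
Proof.
move=> H; rewrite -sum_nat_const.
elim/big_rec2: _ => [|i k B Pi IH]; first by rewrite cards0.
by rewrite cardsU (leq_trans (leq_subr _ _)) // leq_add // H.
Qed.

Lemma card_nongeneric :
  (#|nongeneric| <= #|params (q := q) setT| ^ 2 * (2 ^ (2 * q) * 2 ^ (q * q - m * q)))%N.
Proof.
apply: leq_trans (card_bigcup_leq (n := 2 ^ (2 * q) * 2 ^ (q * q - m * q)) _) _.
  by move=> [p p'] /andP[]; rewrite in_setX => /andP[Pp Pp'] /=; apply: card_agree.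
rewrite leq_mul2r -mulnn -cardsX; apply/orP; right.
by apply: subset_leq_card; apply/subsetP => x /andP[].
Qed.

(** Every parameter set has at most [2 ^ (4 * q)] elements. The value 52 is the first with
    [q.-1 %/ 3 >= 17], and [17 * q] covers the [15 * q] of the crude bounds together with the
    [2 * q] lost in passing from [q ^ 2] to [(q - 1) ^ 2]. *)
Lemma nongeneric_small (S : {set F}) : (52 <= q)%N ->
  (#|params S| * #|nongeneric| * 2 ^ q <= #|cocycles q|)%N.
Proof.
move=> q52.
have cP (S' : {set F}) : (#|params S'| <= 2 ^ (4 * q))%N.
  have cS : (#|S'| <= 2 ^ q)%N.
    apply: leq_trans (max_card _) _; rewrite card_Fp //; exact/ltnW/ltn_expl.
  rewrite card_params // (_ : 4 * q = q + (q * 2) + q)%N; last by lia.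
  rewrite !expnD expnM; apply: leq_mul; first apply: leq_mul.
  - by apply: leq_trans (leq_pred _) _; exact/ltnW/ltn_expl.
  - by rewrite leq_exp2r.
  - by rewrite leq_exp2l // leq_pred.
apply: leq_trans (_ : 2 ^ (4 * q) * ((2 ^ (4 * q)) ^ 2 * (2 ^ (2 * q) * 2 ^ (q * q - m * q))) * 2 ^ q <= _)%N.
  rewrite leq_mul2r; apply/orP; right; apply: leq_mul => //.
  apply: leq_trans card_nongeneric _; rewrite leq_mul2r leq_exp2r ?cP ?orbT //.
rewrite card_cocycles // -expnM -!expnD leq_exp2l //.
(* The exponents add up to 15 q + q^2 - m q, to be compared with (q - 1)^2. *)
have m17 : (17 <= m)%N by rewrite /m; lia.
have qm : (m * q <= q * q)%N by rewrite leq_mul2r /m; lia.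
nia.
Qed.

(** The product [N * M] equals the number of cocycles up to a relative excess of at most [2 ^ -q],
    with denominators cleared. *)
Definition class_bounds (N M : nat) :=
  (#|cocycles q| <= N * M)%N /\ ((N * M) * 2 ^ q <= #|cocycles q| * (2 ^ q + 1))%N.

Lemma class_boundsI N M : (#|cocycles q| <= N * M <= #|cocycles q| + M * #|nongeneric|)%N ->
  (M * #|nongeneric| * 2 ^ q <= #|cocycles q|)%N -> class_bounds N M.
Proof.
move=> /andP[lo hi] sm; split=> //.
apply: leq_trans (_ : (#|cocycles q| + M * #|nongeneric|) * 2 ^ q <= _)%N.
  by rewrite leq_mul2r hi orbT.
by rewrite mulnDl mulnDr muln1 leq_add2l.
Qed.

Notation extl th := (extloop q_pr (cocycle_fun th)).

Lemma extl_nilpotent : {in cocycles q, forall th, extl th \in nilpotent_loops (2 * q)}.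
Proof. by move=> th _; rewrite inE; apply/asboolP/extloop_nilpotent. Qed.

Lemma nilpotent_extl (Q : loop 'I_(2 * q)) : Q \in nilpotent_loops (2 * q) ->
  exists2 th, th \in cocycles q & isomorphic (extl th) Q.
Proof.
rewrite inE => /asboolP/(nilpotent_isomorphic_ext q_pr q_odd)[c nc iso].
have E : cocycle_fun [set w | c w.1 w.2] = c.
  by apply/funext => x; apply/funext => y; rewrite /cocycle_fun inE.
by exists [set w | c w.1 w.2]; rewrite ?E //; apply/cocyclesP; rewrite E.
Qed.

Lemma isotopism_bounds : (52 <= q)%N ->
  class_bounds (nilpotent_upto_isotopism (2 * q)) (q.-1 * q ^ 2 * 2 ^ q.-1).
Proof.
move=> q52.
have -> : (q.-1 * q ^ 2 * 2 ^ q.-1 = #|params (q := q) setT|)%N.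
  by rewrite card_params // cardsT card_Fp.
apply: class_boundsI (nongeneric_small _ q52).
apply: (class_count (Phi := fun th => extl th) (act := @param_act q)).
- exact: isotopic_equiv.
- exact: extl_nilpotent.
- move=> Q /nilpotent_extl[th Xth iso]; exists th => //.
  have eqv := @isotopic_equiv 'I_(2 * q).
  have Hi : `[< isotopic (extl th) Q >] by apply/asboolP/isomorphic_isotopic.
  (* Symmetry extracted from [equivalence_rel]: a relation between x and y equates [R x x] with
     [R y x]. *)
  by have [_ /(_ Hi) <-] := eqv (extl th) Q (extl th); have [] := eqv Q Q (extl th).
- by move=> th eta Xth Xeta; apply/asboolP/idP => /isotopic_extP; apply.
- by move=> p th Pp _; apply: param_act_cocycle Pp.
- exact: generic_inj.
- exact: nongeneric_cocycles.
Qed.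

Lemma isomorphism_bounds : (52 <= q)%N ->
  class_bounds (nilpotent_upto_isomorphism (2 * q)) (q.-1 * 2 ^ q.-1).
Proof.
move=> q52.
have -> : (q.-1 * 2 ^ q.-1 = #|params (q := q) [set 0%R : F]|)%N.
  by rewrite card_params // cards1 exp1n muln1.
apply: class_boundsI (nongeneric_small _ q52).
apply: (class_count (Phi := fun th => extl th) (act := @param_act q)).
- exact: isomorphic_equiv.
- exact: extl_nilpotent.
- move=> Q /nilpotent_extl[th Xth iso]; exists th => //.
  have eqv := @isomorphic_equiv 'I_(2 * q).
  have Hi : `[< isomorphic (extl th) Q >] by apply/asboolP.
  by have [_ /(_ Hi) <-] := eqv (extl th) Q (extl th); have [] := eqv Q Q (extl th).
- by move=> th eta Xth Xeta; apply/asboolP/idP => /isomorphic_extP; apply.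
- by move=> p th Pp _; apply: param_act_cocycle Pp.
- exact: generic_inj.
- exact: nongeneric_cocycles.
Qed.

End Counting.

(** * Asymptotics *)

From mathcomp Require Import classical_sets reals topology normedtype sequences.
Import Order.TTheory Num.Theory numFieldNormedType.Exports.
Local Open Scope classical_set_scope.

Lemma class_bounds_ratio (R : realType) (q N M : nat) : prime q -> class_bounds q N M ->
  1 <= (N%:R : R) * M%:R / 2 ^+ (q.-1 ^ 2) <= 1 + 2^-1 ^+ q.
Proof.
move=> q_pr [lo hi].
have c0 : 0 < 2 ^+ (q.-1 ^ 2) :> R by rewrite exprn_gt0.
have d0 : 0 < 2 ^+ q :> R by rewrite exprn_gt0.
rewrite ler_pdivlMr // ler_pdivrMr // mul1r.
rewrite !card_cocycles // in lo hi.
apply/andP; split.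
  by rewrite -natrX -natrM ler_nat.
rewrite -(ler_pM2r d0) exprVn [leRHS]mulrAC mulrDl mul1r mulVf ?gt_eqF //.
by move: hi; rewrite -(ler_nat R) !natrM natrD !natrX [leRHS]mulrC.
Qed.

Lemma class_bounds_cvg (R : realType) (N M : nat -> nat) :
  (forall q, prime q -> odd q -> (52 <= q)%N -> class_bounds q (N q) (M q)) ->
  (N q)%:R * (M q)%:R / 2 ^+ (q.-1 ^ 2)
    @[q --> within [set q | prime q /\ odd q] \oo] --> (1 : R).
Proof.
move=> H.
apply: (squeeze_cvgr (f := fun=> 1 : R) (h := fun q => 1 + 2^-1 ^+ q)).
- rewrite near_withinE; exists 52 => // q /= q52 [q_pr q_odd].
  exact/class_bounds_ratio/H.
- exact: cvg_cst.
- apply: cvg_trans (_ : 1 + 2^-1 ^+ q @[q --> \oo] --> (1 : R)).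
    apply: cvg_app; exact: cvg_within.
  rewrite -[X in _ --> X]addr0; apply: cvgD; first exact: cvg_cst.
  apply: cvg_expr; rewrite ger0_norm ?invr_ge0 ?ler0n // invf_lt1 ?ltr0n // ltr1n //.
Qed.

Theorem corollary6p12 (R : realType) :
  ((nilpotent_upto_isotopism (2 * q))%:R
     * ((q ^ 2 * (q - 1))%N%:R / 2 ^+ ((q - 2) * (q - 1)) : R)
     @[q --> within [set q | prime q /\ odd q] \oo] --> (1 : R)) /\
  ((nilpotent_upto_isomorphism (2 * q))%:R
     / ((q ^ 2)%N%:R * (nilpotent_upto_isotopism (2 * q))%:R) : R)
     @[q --> within [set q | prime q /\ odd q] \oo] --> (1 : R).
Proof.
have U := @class_bounds_cvg R (fun q => nilpotent_upto_isotopism (2 * q))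
  (fun q => (q.-1 * q ^ 2 * 2 ^ q.-1)%N) isotopism_bounds.
have V := @class_bounds_cvg R (fun q => nilpotent_upto_isomorphism (2 * q))
  (fun q => (q.-1 * 2 ^ q.-1)%N) isomorphism_bounds.
split.
  apply: cvg_trans U; apply: near_eq_cvg; rewrite near_withinE; exists 2 => // q /= q2 _.
  case: q q2 => [|[|q]] // _; rewrite -mulrA; congr (_ * _).
  (* In the original variable, [(q - 1) ^ 2 = (q - 2) * (q - 1) + (q - 1)]; the last summand cancels
     the factor [2 ^ (q - 1)] that counts coboundaries. *)
  rewrite !subSS !subn0 /= (_ : q.+1 ^ 2 = q * q.+1 + q.+1)%N; last first.
    by rewrite -mulnn mulSn addnC.
  rewrite exprD (natrM _ _ (2 ^ q.+1)) natrX mulnC.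
  by rewrite invfM mulrACA divff ?mulr1 // expf_neq0 // pnatr_eq0.
(* In the quotient of the two limits the number of cocycles cancels, and the two parameter counts
   differ exactly by the factor [q ^ 2]. *)
have := cvgM V (cvgV (oner_neq0 R) U); rewrite invr1 mulr1 => W.
apply: cvg_trans (W _ _); apply: near_eq_cvg; rewrite near_withinE; exists 2 => // q /= q2 _.
rewrite mulnAC (natrM _ (_ * _) (q ^ 2)).
set n := (nilpotent_upto_isomorphism _)%:R; set k := (nilpotent_upto_isotopism _)%:R.
have m0 : (q.-1 * 2 ^ q.-1)%N%:R != 0 :> R.
  by rewrite pnatr_eq0 muln_eq0 expn_eq0 orbF; case: q q2 {n k} => [|[]].
have x0 : 2 ^+ (q.-1 ^ 2) != 0 :> R by rewrite expf_neq0 // pnatr_eq0.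
move: (_ * _)%N%:R m0 (2 ^+ _) x0 => m m0 x x0.
rewrite !invfM invrK; move: n k^-1 (q ^ 2)%N%:R^-1 => n' k' s'.
by field; rewrite m0 x0.
Qed.
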